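(* Let $R$ and $S$ be commutative rings with identity, $f:R\to S$ a ring homomorphism (preserving identities), and $J$ a non-zero proper ideal of $S$ with $J\subseteq \mathrm{Nil}(S)$. Suppose that: (a) $Z(R)^2=0$; (b) for every $r\in \mathrm{Reg}(R)$ and every $j\in J\setminus\{0\}$, $jf(r)\neq 0$; and that the following property (c) does not hold: for every $r\in Z(R)\setminus\{0\}$ and every $j\in J\setminus\{0\}$, $jf(r)=0$. Then $\mathrm{diam}(\Gamma(R\bowtie^f J))=2$.
   Context: The amalgamation of $R$ with $S$ along $J$ with respect to $f$ is the subring $R\bowtie^f J=\{(r,f(r)+j)\mid r\in R,\ j\in J\}$ of $R\times S$. For a commutative ring $A$, $Z(A)$ is the set of zero-divisors of $A$ (including $0$), $\mathrm{Reg}(A)=A\setminus Z(A)$ is the set of regular elements, and $\mathrm{Nil}(A)$ is the set of nilpotent elements; $Z(A)^2=0$ means $xy=0$ for all $x,y\in Z(A)$ (including $x=y$). The zero-divisor graph $\Gamma(A)$ is the undirected graph with vertex set $Z(A)\setminus\{0\}$ in which distinct vertices $x,y$ are adjacent if and only if $xy=0$. The diameter $\mathrm{diam}(G)$ of a connected graph $G$ is the supremum of the distances (lengths of shortest paths) between its vertices. *)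

(* Defs.v *)
From HB Require Import structures.
From mathcomp Require Import all_boot all_order all_algebra.
From mathcomp Require Import boolp classical_sets.
Set Implicit Arguments.
Unset Strict Implicit.
Unset Printing Implicit Defensive.
Import Order.TTheory GRing.Theory.
Local Open Scope ring_scope.

Section RingElements.
Variable A : comNzRingType.

(* This includes x = 0 (take y = 1), since 1 != 0 in A. *)
Definition zero_divisor (x : A) : Prop := exists2 y : A, y != 0 & x * y = 0.

Definition regular (x : A) : Prop := ~ zero_divisor x.

Definition nilpotent_elt (x : A) : Prop := exists n : nat, x ^+ n = 0.

End RingElements.

Section Amalgamation.
Variables (R S : comNzRingType) (f : {rmorphism R -> S}) (J : idealr S).

Definition amalg_pred : {pred R * S} :=
  fun x => `[< exists r j, j \in J /\ x = (r, f r + j) >].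

Lemma amalg_predP (x : R * S) :
  reflect (exists r j, j \in J /\ x = (r, f r + j)) (x \in amalg_pred).
Proof. exact: asboolP. Qed.

Lemma amalg_subring_closed : subring_closed amalg_pred.
Proof.
split=> [|_ _ /amalg_predP[r [j [Jj ->]]] /amalg_predP[s [k [Jk ->]]]
         |_ _ /amalg_predP[r [j [Jj ->]]] /amalg_predP[s [k [Jk ->]]]];
  apply/amalg_predP.
- by exists 1, 0; rewrite idealr0 rmorph1 addr0.
- exists (r - s), (j - k); split; first exact: rpredB.
  by congr (_, _); rewrite rmorphB /= opprD addrACA.
- exists (r * s), (f r * k + (f s + k) * j); split.
    by rewrite rpredD ?idealMr.
  congr (_, _); rewrite rmorphM /= mulrDl mulrDr -addrA.
  by rewrite [j * _]mulrC.
Qed.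

HB.instance Definition _ :=
  GRing.isSubringClosed.Build (R * S)%type amalg_pred amalg_subring_closed.

Record amalgamation := Amalgamation {
  amalg_val :> R * S;
  _ : amalg_val \in amalg_pred
}.

HB.instance Definition _ := [isSub for amalg_val].
HB.instance Definition _ := [Choice of amalgamation by <:].
HB.instance Definition _ := [SubChoice_isSubComNzRing of amalgamation by <:].

End Amalgamation.

Section Graph.
Variables (V : eqType) (e : rel V).

(* A path from x to y with n edges and no repeated vertex. *)
Definition path_of_length (x y : V) (n : nat) : Prop :=
  exists p : seq V,
    [/\ path e x p, uniq (x :: p), last x p = y & size p = n].

Definition connected_graph : Prop :=
  forall x y : V, exists n, path_of_length x y n.

Definition is_distance (x y : V) (n : nat) : Prop :=
  path_of_length x y n /\ forall m, path_of_length x y m -> (n <= m)%N.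

Definition has_diameter (d : nat) : Prop :=
  connected_graph /\
  supremums [set n : nat | exists x y : V, is_distance x y n]%classic d.

End Graph.

Section ZeroDivisorGraph.
Variable A : comNzRingType.

Definition zd_vertex := {x : A | `[< zero_divisor x >] && (x != 0)}.

Definition zd_graph : rel zd_vertex :=
  fun x y => (x != y) && (val x * val y == 0).

End ZeroDivisorGraph.

(* Main.v *)
Require Import Defs.
From HB Require Import structures.
From mathcomp Require Import all_boot all_order all_algebra.
From mathcomp Require Import boolp classical_sets.
Import GRing.Theory.
Local Open Scope ring_scope.

(** Why the diameter is 2.  Two nilpotent elements [a], [b] of a ring have a
    common nonzero annihilator inside every nonzero ideal: multiply a nonzero
    element of the ideal by [a] as long as the product survives, then by [b]
    ([common_annihilator]).  So it suffices to see that the second component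
    [f r + j] of a zero-divisor [(r, f r + j)] is nilpotent.  First, [r] must be
    a zero-divisor: if [r] is regular, an annihilator of [(r, f r + j)] has the
    form [(0, k)] with [k] in [J], and after multiplying [k] by a suitable power
    of the nilpotent [j] one gets a nonzero [k'] in [J] with [k' * j = 0], hence
    [k' * f r = 0], against hypothesis (b) ([amalg_zero_divisor_fst]).  Now
    [r ^+ 2 = 0] by (a), so [(f r + j) ^+ 2] lies in the nil ideal [J]
    ([amalg_nilpotent_snd]).  The common annihilators, taken in [J], give
    vertices [(0, w)] joining any two zero-divisors, so distances are at most 2.

    Distance 2 occurs because (c) fails: if [j * f r != 0] with [r] a nonzero
    zero-divisor and [j] in [J], then [(r, f r)] and [(0, j)] are distinct
    non-adjacent vertices; they are zero-divisors, again because their second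
    components are nilpotent. *)

(** * Graphs of diameter two *)

Lemma diameter_two (V : eqType) (e : rel V) :
  irreflexive e ->
  (forall x y, x != y -> ~~ e x y -> exists z, e x z && e z y) ->
  (exists x y, (x != y) && ~~ e x y) ->
  has_diameter e 2.
Proof.
move=> eirr e2 [x0 [y0 /andP[nxy0 nexy0]]].
have neq_of_edge x y : e x y -> x != y.
  by apply: contraTneq => ->; rewrite eirr.
have path2 x y : exists2 n, (n <= 2)%N & path_of_length e x y n.
  have [<-|nxy] := eqVneq x y; first by exists 0%N => //; exists [::].
  have [exy|nexy] := boolP (e x y).
    by exists 1%N => //; exists [:: y]; split; rewrite /= ?exy ?inE ?nxy.
  have [z /andP[exz ezy]] := e2 x y nxy nexy.
  exists 2%N => //; exists [:: z; y]; split=> //=; first by rewrite exz ezy.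
  by rewrite !inE negb_or nxy !neq_of_edge.
split; first by move=> x y; have [n _ pn] := path2 x y; exists n.
split=> [n [x [y [_ nmin]]]|d ubd].
  by have [m m2 /nmin nm] := path2 x y; exact: leq_trans nm m2.
apply: ubd; exists x0, y0.
have ge2 m : path_of_length e x0 y0 m -> (2 <= m)%N.
  case=> -[|u [|v p]] [/= pp _ lst <-] //.
  - by rewrite lst eqxx in nxy0.
  - by move: pp; rewrite lst (negPf nexy0).
split=> //; have [n n2 pn] := path2 x0 y0.
by have /eqP <- : n == 2%N by rewrite eqn_leq n2 ge2.
Qed.

Lemma zd_graph_diameter_two (A : comNzRingType) :
  (forall x y : A, zero_divisor x -> zero_divisor y ->
     exists z, [/\ z != 0, x * z = 0 & y * z = 0]) ->
  (exists x y : A,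
     [/\ zero_divisor x, zero_divisor y, x != y & x * y != 0]) ->
  has_diameter (@zd_graph A) 2.
Proof.
move=> ann [x [y [zx zy nxy xy0]]]; apply: diameter_two.
- by move=> u; rewrite /zd_graph eqxx.
- move=> [u pu] [v pv] nuv; rewrite /zd_graph nuv /= => uv0.
  have [/andP[/asboolP zu u0] /andP[/asboolP zv v0]] := (pu, pv).
  have [z [z0 uz vz]] := ann u v zu zv.
  have pz : `[< zero_divisor z >] && (z != 0).
    by rewrite z0 andbT; apply/asboolP; exists u; rewrite // mulrC.
  exists (exist _ z pz); rewrite -!val_eqE /= uz [z * v]mulrC vz eqxx !andbT.
  (* A common annihilator equal to an endpoint would make u, v adjacent. *)
  apply/andP; split; apply: contraNneq uv0 => zE.
    by rewrite zE mulrC vz.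
  by rewrite -zE uz.
- have x0 : x != 0 by apply: contraNneq xy0 => ->; rewrite mul0r.
  have y0 : y != 0 by apply: contraNneq xy0 => ->; rewrite mulr0.
  have px : `[< zero_divisor x >] && (x != 0) by rewrite x0 andbT; apply/asboolP.
  have py : `[< zero_divisor y >] && (y != 0) by rewrite y0 andbT; apply/asboolP.
  exists (exist _ x px), (exist _ y py).
  by rewrite /zd_graph -!val_eqE /= nxy xy0.
Qed.

(** * Annihilators of nilpotent elements *)

(** The last nonzero term of [w, w * a, w * a ^+ 2, ...] is killed by [a]. *)
Lemma last_nonzero_multiple (A : comNzRingType) (w a : A) :
  w != 0 -> nilpotent_elt a ->
  exists m, w * a ^+ m != 0 /\ w * a ^+ m * a = 0.
Proof.
move=> w0 [n an].
have exn : exists n, w * a ^+ n == 0 by exists n; rewrite an mulr0.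
case: (ex_minnP exn) => -[|m] /eqP wm mmin.
  by rewrite expr0 mulr1 in wm; rewrite wm eqxx in w0.
exists m; split; last by rewrite -mulrA -exprSr.
by apply/negP => /mmin; rewrite ltnn.
Qed.

(** Staying inside the ideal is the point: an element of [J] can be placed in
    the second component of the amalgamation above [0]. *)
Lemma common_annihilator {A : comNzRingType} (J : idealr A) (a b : A) :
  (exists2 j : A, j \in J & j != 0) -> nilpotent_elt a -> nilpotent_elt b ->
  exists w, [/\ w \in J, w != 0, a * w = 0 & b * w = 0].
Proof.
move=> [j Jj j0] na nb.
have [m [jm jma]] := last_nonzero_multiple _ j a j0 na.
have [n [jn jnb]] := last_nonzero_multiple _ _ b jm nb.
exists (j * a ^+ m * b ^+ n); split=> //.
- by rewrite mulrC idealMr // mulrC idealMr.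
- by rewrite mulrC mulrAC jma mul0r.
- by rewrite mulrC.
Qed.

(** * Zero-divisors of the amalgamation *)

Section Amalgamation.
Context {R S : comNzRingType} {f : {rmorphism R -> S}} {J : idealr S}.

Definition amalg_mk (r : R) (j : S) (Jj : j \in J) : amalgamation f J :=
  Amalgamation (introT (amalg_predP f J (r, f r + j))
    (ex_intro _ r (ex_intro _ j (conj Jj erefl)))).

Lemma amalg_decomp (x : amalgamation f J) :
  exists2 j, j \in J & (val x).2 = f (val x).1 + j.
Proof. by case: x => x /= /amalg_predP[r [j [Jj ->]]]; exists j. Qed.

Lemma amalg_mul_eq0 (x y : amalgamation f J) :
  x * y = 0 <-> (val x).1 * (val y).1 = 0 /\ (val x).2 * (val y).2 = 0.
Proof.
split=> [/(congr1 val) xy|[xy1 xy2]].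
  by move: (congr1 fst xy) (congr1 snd xy).
apply: val_inj; rewrite rmorphM rmorph0 [LHS]surjective_pairing.
by congr (_, _).
Qed.

Lemma amalg_neq0_snd (x : amalgamation f J) : (val x).2 != 0 -> x != 0.
Proof. by apply: contraNneq => ->. Qed.

Hypothesis J_nil : forall j : S, j \in J -> nilpotent_elt j.

(** When [(val x).1] is regular, [x] can only be annihilated by some [(0, k)];
    replacing [k] by its last nonzero multiple by a power of [j] reduces
    [k * (f r + j) = 0] to [k * f r = 0]. *)
Lemma amalg_zero_divisor_fst (x : amalgamation f J) :
  (forall r : R, regular r ->
     forall j : S, j \in J -> j != 0 -> j * f r != 0) ->
  zero_divisor x -> zero_divisor (val x).1.
Proof.
move=> hb [y y0 /amalg_mul_eq0[xy1 xy2]]; apply: contrapT => reg1.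
have [j Jj xE] := amalg_decomp x; have [k Jk yE] := amalg_decomp y.
have y10 : (val y).1 = 0.
  by apply/eqP/negP => /negP y10; apply: reg1; exists (val y).1.
have k0 : k != 0.
  apply: contraNneq y0 => k0; apply/eqP/val_inj.
  by rewrite rmorph0 [LHS]surjective_pairing yE k0 y10 rmorph0 addr0.
have [m [km kmj]] := last_nonzero_multiple _ k j k0 (J_nil j Jj).
have Jkm : k * j ^+ m \in J by rewrite mulrC idealMr.
rewrite yE y10 rmorph0 add0r in xy2.
move: (hb _ reg1 _ Jkm km).
rewrite -[_ * f _]addr0 -[X in _ + X]kmj -mulrDr -xE.
by rewrite mulrAC [k * _]mulrC xy2 mul0r eqxx.
Qed.

(** [(f r + j) ^+ 2 = (f r + f r + j) * j] as [r * r = 0]; so the square is in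
    the nil ideal. *)
Lemma amalg_nilpotent_snd (r : R) (j : S) :
  r * r = 0 -> j \in J -> nilpotent_elt (f r + j).
Proof.
move=> rr Jj.
have sqE : (f r + j) ^+ 2 = (f r + f r + j) * j.
  rewrite expr2 mulrDl !mulrDr -rmorphM rr rmorph0 add0r !mulrDl.
  by rewrite [j * f r]mulrC addrA.
have [|n sqn] := J_nil ((f r + j) ^+ 2); first by rewrite sqE idealMr.
by exists (2 * n)%N; rewrite exprM.
Qed.

Hypothesis J_neq0 : exists2 j : S, j \in J & j != 0.

Lemma amalg_common_annihilator (x y : amalgamation f J) :
  nilpotent_elt (val x).2 -> nilpotent_elt (val y).2 ->
  exists z, [/\ z != 0, x * z = 0 & y * z = 0].
Proof.
move=> nx ny; have [w [Jw w0 xw yw]] := common_annihilator J _ _ J_neq0 nx ny.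
have zE : f 0 + w = w by rewrite rmorph0 add0r.
exists (amalg_mk 0 w Jw); split.
- by apply: amalg_neq0_snd; rewrite /= zE.
- by apply/amalg_mul_eq0; rewrite /= zE mulr0.
- by apply/amalg_mul_eq0; rewrite /= zE mulr0.
Qed.

End Amalgamation.

(** * The diameter *)

Theorem theorem4p6 (R S : comNzRingType) (f : {rmorphism R -> S})
  (J : idealr S)
  (J_neq0 : exists2 j : S, j \in J & j != 0)
  (J_nil : forall j : S, j \in J -> nilpotent_elt j)
  (ha : forall x y : R, zero_divisor x -> zero_divisor y -> x * y = 0)
  (hb : forall r : R, regular r ->
        forall j : S, j \in J -> j != 0 -> j * f r != 0)
  (hc : ~ (forall r : R, zero_divisor r -> r != 0 ->
           forall j : S, j \in J -> j != 0 -> j * f r = 0)) :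
  has_diameter (@zd_graph (amalgamation f J)) 2.
Proof.
have nil_snd (x : amalgamation f J) :
    zero_divisor (val x).1 -> nilpotent_elt (val x).2.
  move=> zx; have [j Jj ->] := amalg_decomp x.
  by apply: (amalg_nilpotent_snd J_nil) => //; exact: ha.
apply: zd_graph_diameter_two => [x y zx zy|].
  by apply: amalg_common_annihilator => //; apply: nil_snd;
     exact: (amalg_zero_divisor_fst J_nil).
have [r [j [zr r0 Jj jr]]] : exists r j,
    [/\ zero_divisor r, r != 0, j \in J & j * f r != 0].
  apply: contrapT => nex; apply: hc => r zr r0 j Jj _.
  by apply/eqP/negP => /negP jr; apply: nex; exists r, j.
have J0 : 0 \in J by exact: idealr0.
have zd_of_fst (x : amalgamation f J) :
    zero_divisor (val x).1 -> zero_divisor x.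
  move=> /nil_snd nx.
  by have [z [z0 xz _]] := amalg_common_annihilator J_neq0 x x nx nx; exists z.
exists (amalg_mk r 0 J0), (amalg_mk 0 j Jj); split.
- exact: zd_of_fst.
- by apply: zd_of_fst; exists 1; rewrite ?oner_neq0 ?mul0r.
- by apply: contraNneq r0 => /(congr1 (fun x => (val x).1)) /= ->.
- apply: contraNneq jr => /amalg_mul_eq0[_ /=].
  by rewrite rmorph0 add0r addr0 mulrC => ->.
Qed.
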